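(* Let $K/k$ be a purely inseparable extension of characteristic $p>0$, of unbounded exponent and of infinite degree of irrationality $di(K/k)$. If $K/k$ is relatively perfect and modular, then $K/k$ contains a proper subextension $L/k$ (i.e. $k\subseteq L\subsetneq K$) which is of unbounded exponent and modular.
   Context: All fields have characteristic $p>0$ and all extensions are purely inseparable subextensions of a fixed algebraic closure $\Omega$ of $k$. $K/k$ is of finite (bounded) exponent if $K^{p^e}\subseteq k$ for some $e\in\mathbf N$; otherwise it is of unbounded exponent. An $r$-basis of $K/k$ is a subset $B\subseteq K$ with $K=k(K^p)(B)$ and $x\notin k(K^p)(B\setminus\{x\})$ for all $x\in B$; all $r$-bases of $K/k$ have the same cardinality. If $K/k$ has finite exponent, $di(K/k)$ denotes the cardinality of an $r$-basis of $K/k$ (equivalently of a minimal generating set). In general $di(K/k)=\sup_{n\ge 1} di\big((k^{p^{-n}}\cap K)/k\big)$ (supremum of cardinals), where $k^{p^{-n}}=\{a\in\Omega : a^{p^n}\in k\}$. $K/k$ is relatively perfect if $k(K^p)=K$. $K/k$ is modular if for every $n\in\mathbf N$, $K^{p^n}$ and $k$ are linearly disjoint over $K^{p^n}\cap k$. *)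

(* Defs.v *)
From HB Require Import structures.
From mathcomp Require Import all_boot all_order all_algebra.
From mathcomp Require Import boolp classical_sets functions cardinality.

Set Implicit Arguments.
Unset Strict Implicit.
Unset Printing Implicit Defensive.

Import GRing.Theory.
Local Open Scope classical_set_scope.
Local Open Scope card_scope.
Local Open Scope ring_scope.

(* All fields are subfields of one ambient field [Omega], represented as      *)
(* classical sets of elements of [Omega].                                     *)

(* [GRing.divring_closed] asks for 1, x - y and x / y; as 0^-1 = 0 in MathComp, *)
(* in a field this is exactly being a subfield.                               *)
Definition is_subfield (Omega : fieldType) (F : set Omega) : Prop :=
  GRing.divring_closed [in F].

Definition is_extension (Omega : fieldType) (k K : set Omega) : Prop :=
  [/\ is_subfield k, is_subfield K & k `<=` K].

Definition is_algebraic_closure (Omega : closedFieldType) (k : set Omega) :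
    Prop :=
  is_subfield k /\
  forall x : Omega,
    exists q : {poly Omega}, [/\ q != 0, q \is a polyOver [in k] & root q x].

Definition adjoin (Omega : fieldType) (F S : set Omega) : set Omega :=
  smallest (@is_subfield Omega) (F `|` S).

(* [pow_img p n K] is K^(p^n); [pow_root p n k] is k^(p^-n). *)
Definition pow_img (Omega : fieldType) (p n : nat) (K : set Omega) :
    set Omega :=
  (fun x => x ^+ (p ^ n)%N) @` K.

Definition pow_root (Omega : fieldType) (p n : nat) (k : set Omega) :
    set Omega :=
  [set x | k (x ^+ (p ^ n)%N)].

Definition purely_insep (Omega : fieldType) (p : nat) (k K : set Omega) :
    Prop :=
  forall x, K x -> exists n : nat, k (x ^+ (p ^ n)%N).

Definition finite_exponent (Omega : fieldType) (p : nat) (k K : set Omega) :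
    Prop :=
  exists e : nat, pow_img p e K `<=` k.

Definition unbounded_exponent (Omega : fieldType) (p : nat)
    (k K : set Omega) : Prop :=
  ~ finite_exponent p k K.

Definition is_rbasis (Omega : fieldType) (p : nat) (k K B : set Omega) :
    Prop :=
  [/\ B `<=` K,
      adjoin (adjoin k (pow_img p 1 K)) B = K
    & forall x, B x -> ~ adjoin (adjoin k (pow_img p 1 K)) (B `\ x) x].

(* Cardinals are represented by sets, compared by [#<=]. The set [D] bounds   *)
(* every cardinal di((k^(p^-n) `&` K)/k), n >= 1, these being the cardinals   *)
(* of the r-bases of extensions of finite exponent.                           *)
Definition di_ubound (Omega : fieldType) (p : nat) (k K : set Omega)
    (T : Type) (D : set T) : Prop :=
  forall n : nat, (1 <= n)%N ->
  forall B : set Omega, is_rbasis p k (pow_root p n k `&` K) B -> B #<= D.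

(* [C] represents the cardinal di(K/k), the least of these upper bounds;      *)
(* this determines [C] up to equipotence.                                     *)
Definition is_di (Omega : fieldType) (p : nat) (k K : set Omega)
    (T : Type) (C : set T) : Prop :=
  di_ubound p k K C /\
  forall (U : Type) (D : set U), di_ubound p k K D -> C #<= D.

Definition lin_indep (Omega : fieldType) (F : set Omega) (m : nat)
    (x : 'I_m -> Omega) : Prop :=
  forall c : 'I_m -> Omega, (forall i, F (c i)) ->
  \sum_(i < m) c i * x i = 0 -> forall i, c i = 0.

Definition lin_disjoint (Omega : fieldType) (E E' F : set Omega) : Prop :=
  forall (m : nat) (x : 'I_m -> Omega), (forall i, E (x i)) ->
  lin_indep F x -> lin_indep E' x.

Definition relatively_perfect (Omega : fieldType) (p : nat)
    (k K : set Omega) : Prop :=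
  adjoin k (pow_img p 1 K) = K.

Definition modular (Omega : fieldType) (p : nat) (k K : set Omega) : Prop :=
  forall n : nat, lin_disjoint (pow_img p n K) k (pow_img p n K `&` k).

(* Main.v *)
Require Import Defs.
From HB Require Import structures.
From mathcomp Require Import all_boot all_order all_algebra.
From mathcomp Require Import boolp classical_sets functions cardinality.

Set Implicit Arguments.
Unset Strict Implicit.
Unset Printing Implicit Defensive.

Import GRing.Theory.
Local Open Scope classical_set_scope.
Local Open Scope card_scope.
Local Open Scope ring_scope.

(* Write k_j for the elements of K whose p^j-th power is in k. Since K is     *)
(* relatively perfect and modular, k_j lies in the field generated over k by  *)
(* the elements of k_j that are p^n-th powers in K, for every n. Hence the    *)
(* p^(n-1)-st powers of an r-basis of k_n/k are linearly independent over k,  *)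
(* and they lie in k_1; as di(K/k) is infinite, k_1/k has infinite degree.    *)
(* Choose z in k_1 outside k, put E_0 = k(z), and choose inductively a_n in K *)
(* with a_n^(p^(n+1)) in k and a_n^(p^n) outside E_n, where                   *)
(* E_(n+1) = E_n(a_n): if there were no such a_n, all the p^n-th powers in    *)
(* k_1, hence k_1 itself, would lie in E_n, which has finite degree over k.   *)
(* Then L = k(a_0, a_1, ...) is the tensor product of the k(a_n), which are   *)
(* simple of exponent n + 1. So L is modular of unbounded exponent, and it    *)
(* does not contain z.                                                        *)

(** Relative perfection gives K = k(K^(p^n)) for every n ([adjoin_pow_img]). Modularity lets
    independence pass through Frobenius: a family in K^(p^n) independent over those of its elements
    whose p^j-th power is in k has p^j-th powers independent over k ([modular_pow_independent]).
    Together they yield [pow_root_sub_adjoin]: k_j is generated over k by arbitrarily deep p-powers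
    of K. This carries an r-basis of k_n into k_1, so infinite di forces k_1/k to be infinite
    ([infinite_di_root]).

    On the side of L everything rests on [insep_powers_independent], the irreducibility of
    X^(p^(e+1)) - c. The choice of the a_n makes monomials in them a basis adapted to p^m-th powers
    ([tower_pow_lspan]), and such bases imply linear disjointness ([lspan_lin_disjoint]). Choosing
    the a_n over k(z) instead of k keeps L linearly disjoint from k(z), so L meets k(z) only in k
    ([tower_union_descent]) and misses z. *)

Section Subfields.
Variable Omega : fieldType.
Implicit Types (F S : set Omega) (x y : Omega).

Lemma is_subfieldP F :
  is_subfield F <->
  [/\ F 1, forall x y, F x -> F y -> F (x - y) &
      forall x y, F x -> F y -> F (x / y)].
Proof.
split=> [[F1 FB FV]|[F1 FB FV]]; split=> [|x y Fx Fy|x y Fx Fy].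
- exact/set_mem.
- by apply/set_mem/FB; apply/mem_set.
- by apply/set_mem/FV; apply/mem_set.
- exact/mem_set.
- by apply/mem_set/FB; apply/set_mem.
- by apply/mem_set/FV; apply/set_mem.
Qed.

Section Closure.
Variable F : set Omega.
Hypothesis hF : is_subfield F.

Lemma subfield1 : F 1.
Proof. by have [] := (is_subfieldP F).1 hF. Qed.

Lemma subfieldB x y : F x -> F y -> F (x - y).
Proof. by have [_ FB _] := (is_subfieldP F).1 hF; apply: FB. Qed.

Lemma subfield_div x y : F x -> F y -> F (x / y).
Proof. by have [_ _] := (is_subfieldP F).1 hF; apply. Qed.

Lemma subfield0 : F 0.
Proof. by rewrite -(subrr 1); apply: subfieldB; apply: subfield1. Qed.

Lemma subfieldN x : F x -> F (- x).
Proof.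
by move=> Fx; rewrite -sub0r; apply: subfieldB => //; apply: subfield0.
Qed.

Lemma subfieldD x y : F x -> F y -> F (x + y).
Proof.
by move=> Fx Fy; rewrite -(opprK y); apply: subfieldB => //;
  apply: subfieldN.
Qed.

Lemma subfieldV x : F x -> F x^-1.
Proof.
by move=> Fx; rewrite -div1r; apply: subfield_div => //; apply: subfield1.
Qed.

Lemma subfieldM x y : F x -> F y -> F (x * y).
Proof.
by move=> Fx Fy; rewrite -(invrK y); apply: subfield_div => //;
  apply: subfieldV.
Qed.

Lemma subfieldX x n : F x -> F (x ^+ n).
Proof.
by move=> Fx; elim: n => [|n IHn]; rewrite ?expr0 ?exprS;
  [apply: subfield1|apply: subfieldM].
Qed.

Lemma subfield_sum (I : Type) (r : seq I) (P : pred I) (f : I -> Omega) :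
  (forall i, F (f i)) -> F (\sum_(i <- r | P i) f i).
Proof.
move=> Ff; apply: (big_ind F) => //; first exact: subfield0.
by move=> x y; apply: subfieldD.
Qed.

End Closure.

Lemma adjoin_subfield F S : is_subfield (adjoin F S).
Proof.
apply/is_subfieldP; split=> [M [hM _]|x y xA yA M MC|x y xA yA M MC].
- exact: subfield1 hM.
- by apply: (subfieldB MC.1); [apply: xA|apply: yA].
- by apply: (subfield_div MC.1); [apply: xA|apply: yA].
Qed.

Lemma sub_adjoinl F S : F `<=` adjoin F S.
Proof. by move=> x Fx M [_ FSM]; apply: FSM; left. Qed.

Lemma sub_adjoinr F S : S `<=` adjoin F S.
Proof. by move=> x Sx M [_ FSM]; apply: FSM; right. Qed.

Lemma adjoin_sub F S E :
  is_subfield E -> F `<=` E -> S `<=` E -> adjoin F S `<=` E.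
Proof.
by move=> hE FE SE; apply: smallest_sub => // x []; [apply: FE|apply: SE].
Qed.

Lemma subfieldI F S : is_subfield F -> is_subfield S -> is_subfield (F `&` S).
Proof.
move=> hF hS; apply/is_subfieldP;
  split=> [|x y [Fx Sx] [Fy Sy]|x y [Fx Sx] [Fy Sy]].
- by split; apply: subfield1.
- by split; apply: subfieldB.
- by split; apply: subfield_div.
Qed.

End Subfields.

(** * A subfield as a field type *)

Section SubfieldType.
Variables (Omega : fieldType) (F : set Omega) (hF : is_subfield F).

Definition subfield_pred of is_subfield F : {pred Omega} := [in F].

HB.instance Definition _ :=
  GRing.isDivringClosed.Build Omega (subfield_pred hF) hF.

Record subfield_type := SubfieldType
  { subfield_val :> Omega; _ : subfield_val \in subfield_pred hF }.

HB.instance Definition _ := [isSub for subfield_val].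
HB.instance Definition _ := [Choice of subfield_type by <:].
HB.instance Definition _ :=
  [SubChoice_isSubIntegralDomain of subfield_type by <:].
HB.instance Definition _ :=
  [SubIntegralDomain_isSubField of subfield_type by <:].

(** Gives access to the matrix and polynomial theory over F: data with entries in F is pulled back
    along [g] and mapped into [Omega] by the field morphism [f]. *)
Lemma subfield_model : exists (E : fieldType) (f : {rmorphism E -> Omega})
  (g : Omega -> E), (forall y, F (f y)) /\ {in F, cancel g f}.
Proof.
exists subfield_type, (val : {rmorphism subfield_type -> Omega}), (insubd 0).
by split=> [y|x Fx]; [apply/set_mem/(valP y)|exact: insubdK].
Qed.

End SubfieldType.

(** * Independence, spans and linear disjointness over a subfield *)

Section LinearAlgebra.
Variable Omega : fieldType.
Implicit Types F G A : set Omega.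

Definition independent F (I : finType) (u : I -> Omega) : Prop :=
  forall c : I -> Omega, (forall i, F (c i)) ->
  \sum_i c i * u i = 0 -> forall i, c i = 0.

Definition lspan F (I : finType) (u : I -> Omega) : set Omega :=
  [set x | exists2 c : I -> Omega, (forall i, F (c i)) & x = \sum_i c i * u i].

Definition finite_dim F A : Prop :=
  exists (I : finType) (u : I -> Omega), A `<=` lspan F u.

Lemma sum_enum_val (I : finType) (f : I -> Omega) :
  \sum_i f i = \sum_(j < #|I|) f (enum_val j).
Proof.
by transitivity (\sum_(i in I) f i); [apply: eq_bigl|apply: big_enum_val].
Qed.

Lemma independent_enum F (I : finType) (u : I -> Omega) :
  independent F u <-> lin_indep F (fun j : 'I_#|I| => u (enum_val j)).
Proof.
split=> iu c Fc c0 i.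
  rewrite -(enum_valK i); apply: (iu (fun i => c (enum_rank i))) => //.
  by rewrite sum_enum_val; apply: etrans c0; apply: eq_bigr => j _;
    rewrite enum_valK.
rewrite -(enum_rankK i); apply: (iu (c \o enum_val)) => [j|]; first exact: Fc.
by apply: etrans c0; rewrite [RHS]sum_enum_val.
Qed.

Lemma lin_disjointP (E E' F : set Omega) : lin_disjoint E E' F ->
  forall (I : finType) (u : I -> Omega), (forall i, E (u i)) ->
  independent F u -> independent E' u.
Proof.
by move=> dis I u Eu /independent_enum iu; apply/independent_enum; apply: dis.
Qed.

Lemma independent_sub F G (I : finType) (u : I -> Omega) :
  F `<=` G -> independent G u -> independent F u.
Proof. by move=> FG iu c Fc; apply: iu => i; apply: FG. Qed.

Section Span.
Variables (F : set Omega) (hF : is_subfield F) (I : finType) (u : I -> Omega).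

Lemma lspan0 : lspan F u 0.
Proof.
exists (fun=> 0); first by move=> _; apply: subfield0.
by rewrite big1 // => i _; rewrite mul0r.
Qed.

Lemma lspanD x y : lspan F u x -> lspan F u y -> lspan F u (x + y).
Proof.
move=> [c Fc ->] [d Fd ->]; exists (fun i => c i + d i).
  by move=> i; apply: subfieldD.
by rewrite -big_split; apply: eq_bigr => i _; rewrite mulrDl.
Qed.

Lemma lspan_sum (J : Type) (r : seq J) (P : pred J) (f : J -> Omega) :
  (forall j, lspan F u (f j)) -> lspan F u (\sum_(j <- r | P j) f j).
Proof.
move=> uf; apply: (big_ind (lspan F u)) => //; first exact: lspan0.
exact: lspanD.
Qed.

Lemma lspanZ a x : F a -> lspan F u x -> lspan F u (a * x).
Proof.
move=> Fa [c Fc ->]; exists (fun i => a * c i).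
  by move=> i; apply: subfieldM.
by rewrite mulr_sumr; apply: eq_bigr => i _; rewrite mulrA.
Qed.

Lemma lspan_gen i : lspan F u (u i).
Proof.
exists (fun j => (j == i)%:R).
  by move=> j; case: eqP => _; [apply: subfield1|apply: subfield0].
rewrite (bigD1 i) //= eqxx mul1r big1 ?addr0 // => j /negPf ->.
by rewrite mul0r.
Qed.

End Span.

(** Rank does not change under field extension: rows over F without relations over F have none over
    [Omega]. *)
Lemma subfield_row_free F m n (X : 'M[Omega]_(m, n)) : is_subfield F ->
  (forall i j, F (X i j)) ->
  (forall c : 'rV_m, (forall i, F (c 0 i)) -> c *m X = 0 -> c = 0) ->
  row_free X.
Proof.
move=> hF FX indX.
have [E [f [g [Ff fK]]]] := subfield_model hF.
pose Y := map_mx g X.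
have eX : X = map_mx f Y.
  by apply/matrixP => i j; rewrite !mxE fK //; apply/mem_set/FX.
rewrite eX row_free_map -kermx_eq0; apply/eqP/row_matrixP => i.
rewrite row0; apply: (map_mx_inj (f := f)); rewrite map_mx0.
apply: indX => [j|]; first by rewrite mxE.
by rewrite eX -map_mxM -row_mul mulmx_ker row0 map_mx0.
Qed.

Lemma lspan_matrix F m (x : 'I_m -> Omega) (I : finType) (u : I -> Omega) :
  (forall i, lspan F u (x i)) ->
  exists2 X : 'M[Omega]_(m, #|I|), forall i j, F (X i j) &
    forall i, x i = \sum_j X i j * u (enum_val j).
Proof.
move=> /(_ _)/cid2-/all_sig2[c Fc xE].
exists (\matrix_(i, j) c i (enum_val j)) => [i j|i]; rewrite ?mxE //.
by rewrite xE sum_enum_val; apply: eq_bigr => j _; rewrite mxE.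
Qed.

Lemma sum_lspan_matrix m n (X : 'M[Omega]_(m, n)) (c : 'rV_m)
    (x : 'I_m -> Omega) (u : 'I_n -> Omega) :
  (forall i, x i = \sum_j X i j * u j) ->
  \sum_i c 0 i * x i = \sum_j (c *m X) 0 j * u j.
Proof.
move=> xE; under eq_bigr do rewrite xE mulr_sumr.
rewrite exchange_big; apply: eq_bigr => j _; rewrite mxE mulr_suml.
by apply: eq_bigr => i _; rewrite mulrA.
Qed.

(** A family of A independent over G has a coordinate matrix X over G with independent rows, even
    over [Omega]. A relation c over k between its members becomes c X = 0 because [u] is independent
    over k, whence c = 0. *)
Lemma lspan_lin_disjoint A k G : is_subfield G -> is_subfield k -> G `<=` k ->
  (forall m (x : 'I_m -> Omega), (forall i, A (x i)) ->
    exists (I : finType) (u : I -> Omega),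
      independent k u /\ forall i, lspan G u (x i)) ->
  lin_disjoint A k G.
Proof.
move=> hG hk Gk spanA m x Ax ix c kc c0.
have [I [u [iu xu]]] := spanA m x Ax.
have [X GX xE] := lspan_matrix xu.
have fX : row_free X.
  apply: (subfield_row_free hG GX) => d Gd dX; apply/rowP => i; rewrite mxE.
  apply: (ix (fun i => d 0 i)) => //.
  by rewrite (sum_lspan_matrix _ xE) dX big1 // => j _; rewrite mxE mul0r.
have kX i j : k (X i j) by apply: Gk.
suff cX : (\row_i c i) *m X = 0.
  have := row_free_inj fX (etrans cX (esym (mul0mx _ X))).
  by move=> /rowP cz i; move: (cz i); rewrite !mxE.
apply/rowP => j; rewrite [RHS]mxE.
move/independent_enum: iu => /(_ (fun j => ((\row_i c i) *m X) 0 j)); apply.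
  by move=> l; rewrite mxE; apply: (subfield_sum hk) => i; rewrite mxE;
    apply: subfieldM.
rewrite -(sum_lspan_matrix _ xE); apply: etrans c0.
by apply: eq_bigr => i _; rewrite mxE.
Qed.

Lemma independent_leq F m (x : 'I_m -> Omega) (I : finType) (u : I -> Omega) :
  is_subfield F -> independent F x -> (forall i, lspan F u (x i)) ->
  (m <= #|I|)%N.
Proof.
move=> hF ix xu; have [X FX xE] := lspan_matrix xu.
suff /eqP <- : row_free X by apply: rank_leq_col.
apply: (subfield_row_free hF FX) => d Fd dX; apply/rowP => i; rewrite mxE.
apply: (ix (fun i => d 0 i)) => //.
by rewrite (sum_lspan_matrix _ xE) dX big1 // => j _; rewrite mxE mul0r.
Qed.

Lemma lspan_tensor F (I J : finType) (u : I -> Omega) (w : J -> Omega) x j :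
  is_subfield F -> lspan F u x ->
  lspan F (fun ij : I * J => u ij.1 * w ij.2) (x * w j).
Proof.
move=> hF [c Fc ->]; rewrite mulr_suml; apply: lspan_sum => // i.
rewrite -mulrA; apply: lspanZ => //.
exact: (lspan_gen hF (fun ij : I * J => u ij.1 * w ij.2) (i, j)).
Qed.

Lemma finite_dim_lspan F A (J : finType) (w : J -> Omega) :
  is_subfield F -> finite_dim F A -> finite_dim F (lspan A w).
Proof.
move=> hF [I [u Au]]; exists (I * J)%type, (fun ij => u ij.1 * w ij.2).
move=> _ [c Ac ->]; apply: lspan_sum => // j.
by apply: lspan_tensor => //; apply: Au.
Qed.

(** The tower law: group the relation by [w], whose coefficients then lie in E and vanish, and use
    the independence of [u]. *)
Lemma independent_tensor F E (I J : finType) (u : I -> Omega) (w : J -> Omega) :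
  is_subfield E -> F `<=` E -> (forall i, E (u i)) ->
  independent F u -> independent E w ->
  independent F (fun ij : I * J => u ij.1 * w ij.2).
Proof.
move=> hE FE Eu iu iw c Fc c0 [i j].
pose d j := \sum_i c (i, j) * u i.
suff dj : d j = 0 by apply: (iu (fun i => c (i, j))).
apply: (iw d) => [j'|].
  by apply: subfield_sum => // i'; apply: subfieldM => //; apply: FE.
rewrite -[RHS]c0 (eq_bigr (fun ij => c (ij.1, ij.2) * (u ij.1 * w ij.2)));
  last by case.
rewrite -(pair_bigA _ (fun i j => c (i, j) * (u i * w j))) exchange_big /=.
by apply: eq_bigr => j' _; rewrite mulr_suml; apply: eq_bigr => i' _;
  rewrite mulrA.
Qed.

End LinearAlgebra.

(** * Frobenius and purely inseparable elements *)

Section Frobenius.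
Variables (Omega : fieldType) (p : nat).
Hypothesis charp : p \in [pchar Omega].
Implicit Types (F k K : set Omega) (x y a : Omega).

Lemma pchar_prime : prime p.
Proof. by case/andP: charp. Qed.

Lemma pchar_pnat n : [pchar Omega].-nat (p ^ n)%N.
Proof. by rewrite pnatX pnatE ?charp // pchar_prime. Qed.

Lemma expn_pchar_gt0 n : (0 < p ^ n)%N.
Proof. by rewrite expn_gt0 prime_gt0 ?pchar_prime. Qed.

Lemma frobD n x y : (x + y) ^+ (p ^ n) = x ^+ (p ^ n) + y ^+ (p ^ n).
Proof. exact/exprDn_pchar/pchar_pnat. Qed.

Lemma frob0 n : 0 ^+ (p ^ n) = 0 :> Omega.
Proof. by rewrite expr0n eqn0Ngt expn_pchar_gt0. Qed.

Lemma frobB n x y : (x - y) ^+ (p ^ n) = x ^+ (p ^ n) - y ^+ (p ^ n).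
Proof. by apply/eqP; rewrite eq_sym subr_eq -frobD subrK. Qed.

Lemma frob_sum n (I : Type) (r : seq I) (P : pred I) (f : I -> Omega) :
  (\sum_(i <- r | P i) f i) ^+ (p ^ n) = \sum_(i <- r | P i) f i ^+ (p ^ n).
Proof. by apply: (big_morph (fun x => x ^+ (p ^ n)) (frobD n) (frob0 n)). Qed.

Lemma frob_eq0 n x : x ^+ (p ^ n) = 0 -> x = 0.
Proof. by move/eqP; rewrite expf_eq0 => /andP[_ /eqP]. Qed.

Lemma frob_iter m n x : (x ^+ (p ^ m)) ^+ (p ^ n) = x ^+ (p ^ (m + n)).
Proof. by rewrite -exprM -expnD. Qed.

Lemma pow_root_subfield n k : is_subfield k -> is_subfield (pow_root p n k).
Proof.
move=> hk; apply/is_subfieldP; split=> [|x y kx ky|x y kx ky];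
  rewrite /pow_root /=.
- by rewrite expr1n; apply: subfield1.
- by rewrite frobB; apply: subfieldB.
- by rewrite expr_div_n; apply: subfield_div.
Qed.

Lemma pow_img_subfield n K : is_subfield K -> is_subfield (pow_img p n K).
Proof.
move=> hK; apply/is_subfieldP;
  split=> [|_ _ [x Kx <-] [y Ky <-]|_ _ [x Kx <-] [y Ky <-]].
- by exists 1; rewrite ?expr1n //; apply: subfield1.
- by exists (x - y); rewrite ?frobB //; apply: subfieldB.
- by exists (x / y); rewrite ?expr_div_n //; apply: subfield_div.
Qed.

Lemma sub_pow_root n k : is_subfield k -> k `<=` pow_root p n k.
Proof. by move=> hk x kx; apply: subfieldX. Qed.

Lemma pow_img_sub n K : is_subfield K -> pow_img p n K `<=` K.
Proof. by move=> hK _ [x Kx <-]; apply: subfieldX. Qed.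

(** Inverses come for free: y^-1 = y^(p^n - 1) / y^(p^n), where the denominator lies in F. *)
Lemma insep_subring_subfield F R : is_subfield F -> F `<=` R ->
  purely_insep p F R ->
  (forall x y, R x -> R y -> R (x - y)) ->
  (forall x y, R x -> R y -> R (x * y)) ->
  is_subfield R.
Proof.
move=> hF FR insepR RB mulR.
have R1 : R 1 by apply: FR; apply: subfield1.
have RX x n : R x -> R (x ^+ n).
  by move=> Rx; elim: n => [|n IHn]; rewrite ?exprS //; apply: mulR => //.
apply/is_subfieldP; split=> // x y Rx Ry; apply: (mulR) => //.
have [n Fyn] := insepR y Ry.
have [->|y0] := eqVneq y 0; first by rewrite invr0; apply: FR; apply: subfield0.
have -> : y^-1 = y ^+ (p ^ n).-1 / y ^+ (p ^ n).
  by rewrite -{2}(prednK (expn_pchar_gt0 n)) exprSr invfM mulrA divff ?mul1r //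
    expf_neq0.
by apply: mulR; [apply: RX|apply: FR; apply: subfieldV].
Qed.

(** Bezout in the exponents; [a != 0] allows the negative coefficient to be realised by a
    division. *)
Lemma exp_gcdn F a m n : is_subfield F -> a != 0 -> (0 < m)%N ->
  F (a ^+ m) -> F (a ^+ n) -> F (a ^+ gcdn m n).
Proof.
move=> hF a0 m0 Fm Fn; case: (egcdnP n m0) => u v uv _.
have -> : a ^+ gcdn m n = (a ^+ m) ^+ u / (a ^+ n) ^+ v.
  by rewrite -!exprM (mulnC m) uv exprD (mulnC n) mulrC mulKf // expf_neq0.
by apply: subfield_div => //; apply: subfieldX.
Qed.

(* A common divisor of [q] and ['X^(p^e.+1) - a^(p^e.+1)] over [F] is         *)
(* associated to a power ['X - a]^m with [m < p^e.+1]. Its constant term puts *)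
(* [a^m] in [F], hence also [a^(gcd(m, p^e.+1))].                             *)
Lemma insep_root_eq0 F a e (q : {poly Omega}) : is_subfield F ->
  F (a ^+ (p ^ e.+1)) -> ~ F (a ^+ (p ^ e)) ->
  (forall i, F q`_i) -> (size q <= p ^ e.+1)%N -> q.[a] = 0 -> q = 0.
Proof.
move=> hF FaN nFa Fq sq qa; apply/eqP/negPn/negP => q0; apply: nFa.
have [->|a0] := eqVneq a 0; first by rewrite frob0; apply: subfield0.
have [E [f [g [Ff fK]]]] := subfield_model hF.
have [r rE] : exists r, map_poly f r = q.
  exists (\poly_(i < size q) g q`_i); apply/polyP => i.
  rewrite coef_map coef_poly; case: ltnP => [_|qi].
    by apply: fK; apply/mem_set/Fq.
  by rewrite (nth_default _ qi); apply: rmorph0.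
set N := (p ^ e.+1)%N in FaN sq.
pose t := 'X^N - (g (a ^+ N))%:P.
have tE : map_poly f t = ('X - a%:P) ^+ N.
  rewrite rmorphB /= map_polyXn map_polyC /= (fK (a ^+ N)); last exact/mem_set.
  have cN : [pchar {poly Omega}].-nat N.
    by rewrite (eq_pnat _ (pchar_poly _)) pchar_pnat.
  by apply/eqP; rewrite subr_eq rmorphXn /= -exprDn_pchar ?subrK.
pose d := map_poly f (gcdp r t).
have dE : d = gcdp q (('X - a%:P) ^+ N) by rewrite /d gcdp_map rE tE.
have da : root d a.
  rewrite dE root_gcd !rootE qa hornerE hornerXsubC subrr.
  by rewrite expr0n eqn0Ngt expn_pchar_gt0 eqxx.
have : d %| ('X - a%:P) ^+ N by rewrite dE dvdp_gcdr.
case/dvdp_exp_XsubCP => m mN dm.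
have m0 : (0 < m)%N.
  by move: da; rewrite (eqp_root dm) lt0n; case: eqP => // ->;
    rewrite expr0 (negPf (root1 _)).
have mlt : (m < N)%N.
  apply: leq_trans sq; rewrite -(size_exp_XsubC m a) -(eqp_size dm).
  by apply: dvdp_leq => //; rewrite dE dvdp_gcdl.
have Fd i : F d`_i by rewrite coef_map; apply: Ff.
have [c c0 dc] := elimT (eqpf_eq _ _) dm.
have Fc : F c.
  have := Fd (size d).-1; rewrite -/(lead_coef d) dc lead_coefZ.
  by rewrite (monicP (monic_exp _ (monicXsubC a))) mulr1.
have Fam : F (a ^+ m).
  have := Fd 0%N; rewrite -horner_coef0 dc hornerZ horner_exp hornerXsubC sub0r.
  move=> Fcm; rewrite -(opprK a) exprNn; apply: subfieldM => //.
    by apply: subfieldX => //; apply: subfieldN => //; apply: subfield1.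
  by rewrite -(mulKf c0 (_ ^+ m)); apply: subfieldM => //; apply: subfieldV.
have Fag := exp_gcdn hF a0 m0 Fam FaN.
(* The gcd divides p^(e+1), so it is some p^j; being at most m < p^(e+1), it has j <= e, and a^(p^e)
   is a power of a^(p^j). *)
have [j _ gE] := elimT (dvdn_pfactor _ _ pchar_prime) (dvdn_gcdr m N).
have je : (j <= e)%N.
  rewrite -ltnS -(ltn_exp2l _ _ (prime_gt1 pchar_prime)) -gE.
  by apply: leq_ltn_trans mlt; apply: dvdn_leq => //; apply: dvdn_gcdl.
rewrite -(subnKC je) -frob_iter; apply: subfieldX => //.
by rewrite -gE.
Qed.

Lemma insep_powers_independent F a e : is_subfield F ->
  F (a ^+ (p ^ e.+1)) -> ~ F (a ^+ (p ^ e)) ->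
  independent F (fun i : 'I_(p ^ e.+1) => a ^+ i).
Proof.
move=> hF FaN nFa c Fc ca0.
(* The coefficients are extended by 0 to all of [nat], so that the relation becomes a polynomial of
   size at most p^(e+1) vanishing at a. *)
pose d (i : nat) := oapp c 0 (insub i).
have dE (i : 'I_(p ^ e.+1)) : d i = c i by rewrite /d valK.
have Fd i : F (d i).
  by rewrite /d; case: insubP => //= _; apply: subfield0.
suff q0 : \poly_(i < p ^ e.+1) d i = 0.
  by move=> i; rewrite -dE; have := coef_poly (p ^ e.+1) d i;
    rewrite q0 coef0 ltn_ord.
apply: (insep_root_eq0 hF FaN nFa).
- by move=> i; rewrite coef_poly; case: ifP => // _; apply: subfield0.
- exact: size_poly.
- by rewrite horner_poly -[RHS]ca0; apply: eq_bigr => i _; rewrite dE.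
Qed.

(** * Simple purely inseparable extensions *)

(** The ring F[a]. It is the field F(a) as soon as some a^(p^e) lies in F, and this form exhibits
    its elements explicitly. *)
Definition simple_adjoin F a : set Omega :=
  [set x | exists2 q : {poly Omega}, (forall i, F q`_i) & x = q.[a]].

Lemma simple_adjoin_sub F a : is_subfield F -> F `<=` simple_adjoin F a.
Proof.
move=> hF x Fx; exists x%:P; last by rewrite hornerC.
by move=> i; rewrite coefC; case: ifP => // _; apply: subfield0.
Qed.

Lemma simple_adjoin_gen F a : is_subfield F -> simple_adjoin F a a.
Proof.
move=> hF; exists 'X; last by rewrite hornerX.
by move=> i; rewrite coefX; case: eqP => _; [apply: subfield1|apply: subfield0].
Qed.

Lemma simple_adjoin_min F a E : is_subfield E -> F `<=` E -> E a ->
  simple_adjoin F a `<=` E.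
Proof.
move=> hE FE Ea _ [q Fq ->]; rewrite horner_coef; apply: subfield_sum => // i.
by apply: subfieldM => //; [apply: FE|apply: subfieldX].
Qed.

Lemma simple_adjoin_pow F a e x : is_subfield F -> F (a ^+ (p ^ e)) ->
  simple_adjoin F a x -> F (x ^+ (p ^ e)).
Proof.
move=> hF Fa [q Fq ->]; rewrite horner_coef frob_sum.
apply: subfield_sum => // i; rewrite exprMn exprAC.
by apply: subfieldM; rewrite //; apply: subfieldX.
Qed.

Lemma simple_adjoin_subfield F a e : is_subfield F -> F (a ^+ (p ^ e)) ->
  is_subfield (simple_adjoin F a).
Proof.
move=> hF Fa; apply: (insep_subring_subfield hF).
- exact: simple_adjoin_sub.
- by move=> x ax; exists e; apply: simple_adjoin_pow ax.
- move=> _ _ [q Fq ->] [r Fr ->]; exists (q - r); last by rewrite !hornerE.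
  by move=> i; rewrite coefB; apply: subfieldB.
- move=> _ _ [q Fq ->] [r Fr ->]; exists (q * r); last by rewrite hornerM.
  by move=> i; rewrite coefM; apply: subfield_sum => // j; apply: subfieldM.
Qed.

Lemma simple_adjoin_lspan F a n : is_subfield F -> (0 < n)%N -> F (a ^+ n) ->
  simple_adjoin F a `<=` lspan F (fun i : 'I_n => a ^+ i).
Proof.
move=> hF n0 Fa _ [q Fq ->]; rewrite horner_coef; apply: lspan_sum => // i.
rewrite {2}(divn_eq i n) exprD mulnC exprM mulrA.
have := @lspan_gen _ F hF 'I_n (fun i => a ^+ i) (Ordinal (ltn_pmod i n0)).
by apply: lspanZ => //; apply: subfieldM => //; apply: subfieldX.
Qed.

Lemma simple_adjoin_finite_dim k F a n : is_subfield k -> is_subfield F ->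
  finite_dim k F -> (0 < n)%N -> F (a ^+ n) ->
  finite_dim k (simple_adjoin F a).
Proof.
move=> hk hF fdF n0 Fa.
have [I [u Fu]] := finite_dim_lspan (fun i : 'I_n => a ^+ i) hk fdF.
by exists I, u; apply: subset_trans Fu; apply: simple_adjoin_lspan.
Qed.

(** The powers of a below p^(e+1) span F(a) over F and stay independent over E. Comparing the
    expansion of z over F with the expansion z * 1 over E shows that z is its own constant
    coefficient. *)
Lemma simple_adjoin_descent F E a e z : is_subfield F -> is_subfield E ->
  F `<=` E -> F (a ^+ (p ^ e.+1)) -> ~ E (a ^+ (p ^ e)) -> E z ->
  simple_adjoin F a z -> F z.
Proof.
move=> hF hE FE Fa nEa Ez az.
have [c Fc zE] := simple_adjoin_lspan hF (expn_pchar_gt0 _) Fa az.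
have ia := insep_powers_independent hE (FE _ Fa) nEa.
pose i0 : 'I_(p ^ e.+1) := Ordinal (expn_pchar_gt0 _).
pose d i := c i - (i == i0)%:R * z.
have : d i0 = 0.
  apply: (ia d) => [i|].
    apply: subfieldB => //; first exact: FE.
    by case: eqP => _; rewrite ?mul1r ?mul0r //; apply: subfield0.
  under eq_bigr do rewrite mulrBl.
  rewrite sumrB -zE (bigD1 i0) //= ?eqxx mul1r expr0 mulr1.
  rewrite big1 ?addr0 ?subrr // => i /negPf->.
  by rewrite !mul0r.
rewrite /d eqxx mul1r => /eqP; rewrite subr_eq0 => /eqP <-.
exact: Fc.
Qed.

End Frobenius.

(** * Roots of elements of k in a relatively perfect modular extension *)

Section RootsInRelativelyPerfect.
Variables (Omega : fieldType) (p : nat).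
Hypothesis charp : p \in [pchar Omega].
Variables k K : set Omega.
Hypotheses (hk : is_subfield k) (hK : is_subfield K) (kK : k `<=` K).
Hypotheses (insepK : purely_insep p k K) (rperfK : relatively_perfect p k K).
Hypothesis modK : modular p k K.

(** Induction on n: raising K = k(K^(p^n)) to the power p puts K^p inside k(K^(p^(n+1))), and K =
    k(K^p). *)
Lemma adjoin_pow_img n : K `<=` adjoin k (pow_img p n K).
Proof.
elim: n => [|n IHn].
  by move=> x Kx; apply: (@sub_adjoinr _ k); exists x; rewrite ?expr1.
set A := adjoin k _; have hA : is_subfield A by apply: adjoin_subfield.
suff KpA : K `<=` pow_root p 1 A.
  rewrite -{1}rperfK; apply: adjoin_sub => //; first exact: sub_adjoinl.
  by move=> _ [x Kx <-]; apply: KpA.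
apply: (subset_trans IHn); apply: adjoin_sub.
- exact: (pow_root_subfield charp).
- by apply: subset_trans (sub_pow_root _ _ hA); apply: sub_adjoinl.
- move=> _ [x Kx <-]; rewrite /pow_root /= frob_iter addn1.
  by apply: (@sub_adjoinr _ k); exists x.
Qed.

(** The sums of products of elements of Q and M form a ring between k and K, which is a field by
    pure inseparability. *)
Lemma adjoin_subfield_sum Q M x : is_subfield Q -> is_subfield M ->
  k `<=` Q -> Q `<=` K -> M `<=` K -> adjoin k M x ->
  exists (I : finType) (c y : I -> Omega),
    [/\ forall i, Q (c i), forall i, M (y i) & x = \sum_i c i * y i].
Proof.
move=> hQ hM kQ QK MK.
set R := fun x => exists (I : finType) (c y : I -> Omega),
  [/\ forall i, Q (c i), forall i, M (y i) & x = \sum_i c i * y i].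
have kR : k `<=` R.
  move=> z kz; exists unit, (fun=> z), (fun=> 1); split=> [_|_|].
  - exact: kQ.
  - exact: subfield1.
  - by rewrite (bigD1 tt) //= mulr1 big1 ?addr0 // => -[].
have MR : M `<=` R.
  move=> z Mz; exists unit, (fun=> 1), (fun=> z); split=> // [_|].
  - exact: subfield1.
  - by rewrite (bigD1 tt) //= mul1r big1 ?addr0 // => -[].
have hR : is_subfield R.
  apply: (insep_subring_subfield charp hk kR).
  - move=> _ [I [c [y [Qc My ->]]]]; apply: insepK; apply: subfield_sum => // i.
    by apply: subfieldM => //; [apply: QK|apply: MK].
  - move=> _ _ [I [c [y [Qc My ->]]]] [J [d [z [Qd Mz ->]]]].
    exists (I + J)%type, (fun i => match i with inl i => c i | inr j =>
      - d j end).
    exists (fun i => match i with inl i => y i | inr j => z j end).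
    split=> [[]// j|[]//|]; first exact: subfieldN.
    rewrite big_sumType /= -sumrN; congr (_ + _).
    by apply: eq_bigr => j _; rewrite mulNr.
  - move=> _ _ [I [c [y [Qc My ->]]]] [J [d [z [Qd Mz ->]]]].
    exists (I * J)%type, (fun i => c i.1 * d i.2), (fun i => y i.1 * z i.2).
    split=> [i|i|]; [exact: subfieldM|exact: subfieldM|].
    rewrite big_distrlr /= pair_bigA /=; apply: eq_bigr => i _.
    by rewrite mulrACA.
exact: (adjoin_sub hR kR MR).
Qed.

(** Frobenius carries independence over the elements of K^(p^n) with p^j-th power in k to
    independence over the intersection of K^(p^(n+j)) with k; linear disjointness then extends it to
    k. *)
Lemma modular_pow_independent j n (I : finType) (y : I -> Omega) :
  (forall i, pow_img p n K (y i)) ->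
  independent (pow_img p n K `&` pow_root p j k) y ->
  independent k (fun i => y i ^+ (p ^ j)).
Proof.
move=> My iy; apply: (lin_disjointP (@modK (n + j)%N)) => [i|c Gc c0 i].
  by have [z Kz <-] := My i; exists z; rewrite ?frob_iter.
have /choice[d dE] i' : exists d, (pow_img p n K `&` pow_root p j k) d /\ d ^+
  (p ^ j) = c i'.
  have [[z Kz zE] kc] := Gc i'; exists (z ^+ (p ^ n)).
  rewrite frob_iter; split=> //; split; first by exists z.
  by rewrite /pow_root /= frob_iter zE.
rewrite -(dE i).2 (iy d) ?frob0 // => [i'|]; first exact: (dE i').1.
apply: (frob_eq0 (p := p) (n := j)); rewrite frob_sum //; apply: etrans c0.
by apply: eq_bigr => i' _; rewrite exprMn (dE i').2.
Qed.

(** Since K = k(M), x is a combination of elements of M, shortened by induction. Coefficients are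
    allowed in Q, not just in k, because each elimination introduces elements of [Mj]; their p^j-th
    powers are still in k. *)
Lemma pow_root_sub_adjoin j n :
  K `&` pow_root p j k `<=` adjoin k (pow_img p n K `&` pow_root p j k).
Proof.
set M := pow_img p n K; set Mj := M `&` _; set Q := adjoin k Mj.
have hM : is_subfield M by apply: pow_img_subfield.
have MK : M `<=` K by apply: pow_img_sub.
have hR : is_subfield (pow_root p j k) by apply: pow_root_subfield.
have hQ : is_subfield Q by apply: adjoin_subfield.
have kQ : k `<=` Q by apply: sub_adjoinl.
have MjQ : Mj `<=` Q by apply: sub_adjoinr.
have QK : Q `<=` K by apply: adjoin_sub => // x [/MK].
have QR : Q `<=` pow_root p j k.
  by apply: adjoin_sub => // [|x []//]; apply: sub_pow_root.
move=> x [Kx kx].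
(* If the [y i], among them 1, are independent over [Mj], then comparing      *)
(* [x * 1] with [\sum_i c i * y i], both raised to the power [p ^ j], gives   *)
(* [x = c ord0]. Otherwise some [y i0] with [i0 != ord0] can be eliminated.   *)
have descent m : forall c y : 'I_m.+1 -> Omega, y ord0 = 1 ->
    (forall i, Q (c i)) -> (forall i, M (y i)) -> x = \sum_i c i * y i -> Q x.
  elim: m => [|m IHm] c y y0 Qc My xE.
    by rewrite xE big_ord_recl big_ord0 y0 mulr1 addr0.
  have [iy|] := pselect (independent Mj y).
    have ky := modular_pow_independent My iy.
    pose d i := c i ^+ (p ^ j) - (i == ord0)%:R * x ^+ (p ^ j).
    have : d ord0 = 0.
      apply: (ky d) => [i|].
        apply: subfieldB => //; first exact: QR.
        by case: eqP => _; rewrite ?mul1r ?mul0r //; apply: subfield0.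
      under eq_bigr do rewrite mulrBl.
      rewrite sumrB [X in _ - X](bigD1 ord0) //= ?eqxx mul1r y0 expr1n mulr1.
      rewrite [X in _ - (_ + X)]big1 ?addr0 => [|i /negPf->];
        last by rewrite !mul0r.
      apply/eqP; rewrite subr_eq0 xE frob_sum //; apply/eqP.
      by apply: eq_bigr => i _; rewrite exprMn.
    rewrite /d eqxx mul1r -frobB // => /frob_eq0/eqP;
      rewrite subr_eq0 => /eqP <-.
    exact: Qc.
  move=> /existsNP[e /not_implyP[Me /not_implyP[e0 /existsNP[i1 /eqP ei1]]]].
  have hMj : is_subfield Mj by apply: subfieldI.
  (* A relation supported at [ord0] alone would read e ord0 * 1 = 0. *)
  have [i0 [i00 ei0]] : exists i0, i0 != ord0 /\ e i0 != 0.
    apply: contrapT => /forallNP H.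
    have e_eq0 i : i != ord0 -> e i = 0.
      by move=> i0; apply/eqP/negPn/negP => ei; case: (H i).
    move: e0 ei1; rewrite (bigD1 ord0) //= big1 => [|i /e_eq0 ->];
      last by rewrite mul0r.
    rewrite y0 mulr1 addr0 => e0; have [->|/e_eq0 ->] := eqVneq i1 ord0.
      by rewrite e0 eqxx.
    by rewrite eqxx.
  (* Removing [i0] leaves the element 1 in first position. *)
  have lift0 : lift i0 ord0 = ord0 :> 'I_m.+2.
    by apply/val_inj; move: i00; rewrite -val_eqE /= /bump leqn0 => /negPf ->.
  have yi0 : y i0 = - \sum_i e (lift i0 i) / e i0 * y (lift i0 i).
    apply: (mulfI ei0); rewrite mulrN mulr_sumr.
    apply/eqP; rewrite -addr_eq0; apply/eqP;
      rewrite -[RHS]e0 (bigD1_ord i0) //=.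
    by congr (_ + _); apply: eq_bigr => i _; rewrite mulrA mulrCA divff ?mulr1.
  apply: (IHm (fun i => c (lift i0 i) - c i0 * (e (lift i0 i) / e i0)) (fun i
    => y (lift i0 i))).
  - by rewrite lift0.
  - move=> i; apply: (subfieldB hQ) => //; apply: (subfieldM hQ) => //.
    by apply: MjQ; apply: (subfield_div hMj).
  - by move=> i; apply: My.
  - rewrite xE (bigD1_ord i0) //= yi0 mulrN mulr_sumr -sumrN -big_split /=.
    by apply: eq_bigr => i _; rewrite mulrBl addrC -!mulrA.
have [|I [c [y [Qc My xE]]]] := @adjoin_subfield_sum Q M x hQ hM kQ QK MK.
  exact: adjoin_pow_img.
(* The expansion is padded with a term 0 * 1 in front, to meet the condition on [y ord0]. *)
apply: (descent #|I| (fun i => oapp (c \o enum_val) 0 (unlift ord0 i))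
                    (fun i => oapp (y \o enum_val) 1 (unlift ord0 i))).
- by rewrite unlift_none.
- by move=> i; case: (unlift _ _) => [l|]; [apply: Qc|apply: subfield0].
- by move=> i; case: (unlift _ _) => [l|]; [apply: My|apply: subfield1].
- rewrite big_ord_recl unlift_none mul0r add0r xE sum_enum_val.
  by apply: eq_bigr => i _; rewrite liftK.
Qed.


(** A nonzero coefficient in a relation would express its element of B through the others. *)
Lemma rbasis_independent F B m (v : 'I_m -> Omega) :
  is_subfield F -> (forall x, B x -> ~ adjoin F (B `\ x) x) ->
  injective v -> (forall i, B (v i)) -> independent F v.
Proof.
move=> hF minB injv Bv c Fc c0 i; apply: contrapT => /eqP ci0.
apply: (minB _ (Bv i)); set A := adjoin _ _.
have hA : is_subfield A by apply: adjoin_subfield.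
have FA : F `<=` A by apply: sub_adjoinl.
have BA : B `\ v i `<=` A by apply: sub_adjoinr.
have -> : v i = - \sum_(j | j != i) c j / c i * v j.
  apply: (mulfI ci0); rewrite mulrN mulr_sumr.
  apply/eqP; rewrite -addr_eq0; apply/eqP; rewrite -[RHS]c0 [RHS](bigD1 i) //=.
  by congr (_ + _); apply: eq_bigr => j _; rewrite mulrA mulrCA divff ?mulr1.
apply: (subfieldN hA); rewrite -big_filter big_seq_cond.
apply: (big_ind A) => [|x y|j]; [exact: subfield0|exact: subfieldD|].
rewrite andbT mem_filter => /andP[ji _]; apply: (subfieldM hA).
  by apply: FA; apply: (subfield_div hF).
by apply: BA; split; [apply: Bv|move=> /injv/eqP; apply/negP].
Qed.

Lemma card_le_ord (T : Type) (B : set T) N :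
  (forall m (v : 'I_m -> T), injective v -> (forall i, B (v i)) -> (m <= N)%N)
    ->
  B #<= `I_N.
Proof.
move=> leN.
have leN' m : `I_m #<= B -> (m <= N)%N.
  move=> /card_leP[f].
  pose v (i : 'I_m) := val (f (exist _ (nat_of_ord i) (mem_set (ltn_ord i)))).
  apply: (leN m v) => [i j /val_inj fij|i]; last exact/set_mem/valP.
  by have [ij] := @inj _ _ _ f _ _ (mem_set I) (mem_set I) fij; apply: val_inj.
have [/finite_setP[m Bm]|/infiniteP infB] := pselect (finite_set B).
  move: Bm; rewrite card_eq_le => /andP[Bm mB].
  by apply: (card_le_trans Bm); rewrite card_le_II; apply: leN'.
have /leN' : `I_N.+1 #<= B by apply: card_le_trans infB; apply: subset_card_le.
by rewrite ltnn.
Qed.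

(** If d elements spanned k_1 over k, then d would bound every r-basis of every k_(n+1)/k, since the
    p^n-th powers of such an r-basis are independent in k_1; so di would be finite. *)
Lemma infinite_di_root (T : Type) (C : set T) :
  is_di p k K C -> infinite_set C -> ~ finite_dim k (K `&` pow_root p 1 k).
Proof.
move=> [_ minC] infC [I [u spanu]]; apply: infC.
suff /minC leC : di_ubound p k K `I_#|I| by apply: (card_le_finite leC).
case=> // n _ B [BK _ minB]; apply: card_le_ord => m v injv Bv.
set Q := adjoin k _ in minB.
have hQ : is_subfield Q by apply: adjoin_subfield.
have iv := rbasis_independent hQ minB injv Bv.
have Kv i : K (v i) by have [] := BK _ (Bv i).
have kv : independent k (fun i => v i ^+ (p ^ n)).
  apply: (modular_pow_independent (n := 0)) => [i|].
    by exists (v i); rewrite ?expr1.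
  (* k_n lies in k(k_(n+1)^p): it is generated over k by its p-th powers from K, and their p-th
     roots in K belong to k_(n+1). *)
  apply: independent_sub iv => _ [[x Kx <-] kx].
  rewrite expr1 in kx *.
  have : adjoin k (pow_img p 1 K `&` pow_root p n k) x by apply:
    pow_root_sub_adjoin.
  apply: adjoin_sub => //; first exact: sub_adjoinl.
  move=> _ [[y Ky <-] ky]; apply: sub_adjoinr; exists y => //; split=> //.
  by move: ky; rewrite /pow_root /= frob_iter.
apply: (independent_leq hk kv) => i; apply: spanu; split.
  exact: subfieldX.
have [kvi _] := BK _ (Bv i).
by rewrite /pow_root /= frob_iter addn1.
Qed.

End RootsInRelativelyPerfect.

(** * Towers of simple extensions with growing exponents *)

Section Tower.
Variables (Omega : fieldType) (p : nat).
Hypothesis charp : p \in [pchar Omega].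
Implicit Types F K : set Omega.

Fixpoint tower F (a : nat -> Omega) n : set Omega :=
  if n is m.+1 then simple_adjoin (tower F a m) (a m) else F.

Definition tower_union F (a : nat -> Omega) : set Omega :=
  [set x | exists n, tower F a n x].

Lemma tower_subl F F' a n : F `<=` F' -> tower F a n `<=` tower F' a n.
Proof.
move=> FF'; elim: n => //= n IHn _ [q Fq ->].
by exists q => // i; apply: IHn.
Qed.

Section Insep.
Variables (k : set Omega) (a : nat -> Omega).
Hypotheses (hk : is_subfield k) (ka : forall n, k (a n ^+ (p ^ n.+1))).

Section Base.
Variable F : set Omega.
Hypotheses (hF : is_subfield F) (kF : k `<=` F).

Lemma tower_subfield_base n : is_subfield (tower F a n) /\ F `<=` tower F a n.
Proof.
elim: n => [|n [hE FE]] /=; [by split|split].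
  apply: (simple_adjoin_subfield charp hE (e := n.+1)).
  by apply: FE; apply: kF; apply: ka.
exact: (subset_trans FE (simple_adjoin_sub _ hE)).
Qed.

Lemma tower_subfield n : is_subfield (tower F a n).
Proof. by have [] := tower_subfield_base n. Qed.

Lemma tower_base n : F `<=` tower F a n.
Proof. by have [] := tower_subfield_base n. Qed.

Lemma tower_exp n : tower F a n (a n ^+ (p ^ n.+1)).
Proof. by apply: tower_base; apply: kF; apply: ka. Qed.

Lemma tower_mono m n : (m <= n)%N -> tower F a m `<=` tower F a n.
Proof.
move=> /subnK <-; elim: (n - m)%N => [|d IHd] //.
exact: (subset_trans IHd (simple_adjoin_sub _ (tower_subfield _))).
Qed.

Lemma tower_gen n : tower F a n.+1 (a n).
Proof. by apply: simple_adjoin_gen; apply: tower_subfield. Qed.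

Lemma tower_min K n : is_subfield K -> F `<=` K -> (forall n, K (a n)) ->
  tower F a n `<=` K.
Proof. by move=> hK FK Ka; elim: n => //= n IHn; apply: simple_adjoin_min. Qed.

End Base.

Let L := tower_union k a.

Lemma tower_sub_union n : tower k a n `<=` L.
Proof. by move=> x kx; exists n. Qed.

Lemma tower_union_fin (I : finType) (x : I -> Omega) : (forall i, L (x i)) ->
  exists n, forall i, tower k a n (x i).
Proof.
move=> /choice[n nx]; exists (\max_i n i) => i.
by apply: (tower_mono hk _ (leq_bigmax i)).
Qed.

Lemma tower_union_subfield : is_subfield L.
Proof.
have two x y : L x -> L y -> exists n, tower k a n x /\ tower k a n y.
  move=> Lx Ly;
    have [[]//|n nxy] := @tower_union_fin bool (fun b => if b then x else y).
  by exists n; split; [apply: (nxy true)|apply: (nxy false)].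
apply/is_subfieldP; split=> [|x y Lx Ly|x y Lx Ly].
- by exists 0%N; apply: subfield1.
- have [n [nx ny]] := two x y Lx Ly; exists n.
  by apply: subfieldB => //; apply: tower_subfield.
- have [n [nx ny]] := two x y Lx Ly; exists n.
  by apply: subfield_div => //; apply: tower_subfield.
Qed.

Lemma tower_union_base : k `<=` L.
Proof. exact: (@tower_sub_union 0). Qed.

Lemma tower_union_gen n : L (a n).
Proof. by exists n.+1; apply: tower_gen. Qed.

Section Modular.
Hypothesis a_indep : forall n, ~ tower k a n (a n ^+ (p ^ n)).

(* The monomials in the [a i ^+ (p ^ m)] with [m <= i] and exponents below    *)
(* [p ^ (i.+1 - m)]; the other factors of a [p ^ m]-th power are constants.   *)
Lemma tower_pow_lspan m n : exists (I : finType) (u : I -> Omega),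
  [/\ independent k u, forall i, tower k a n (u i) &
      forall x, tower k a n x -> lspan (pow_img p m L `&` k) u (x ^+ (p ^ m))].
Proof.
set G := pow_img p m L `&` k.
have hL := tower_union_subfield.
have hG : is_subfield G by apply: subfieldI => //; apply: pow_img_subfield.
elim: n => [|n [I [u [iu Eu spanu]]]].
  exists unit, (fun=> 1); split=> [c _ c0 []|_|x kx] /=.
  - by move: c0; rewrite (bigD1 tt) //= big1 ?addr0 ?mulr1 // => -[].
  - exact: subfield1.
  - exists (fun=> x ^+ (p ^ m)).
      move=> _; split; last exact: subfieldX.
      by exists x => //; apply: tower_union_base.
    by rewrite (bigD1 tt) //= big1 ?addr0 ?mulr1 // => -[].
set E := tower k a n in Eu spanu;
  have hE : is_subfield E by apply: tower_subfield.
have kE : k `<=` E by apply: tower_base.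
set t := a n ^+ (p ^ m).
have powE q : (q.[a n]) ^+ (p ^ m) = \sum_(i < size q) q`_i ^+ (p ^ m) * t ^+ i.
  rewrite horner_coef frob_sum //; apply: eq_bigr => i _.
  by rewrite exprMn exprAC.
have [nm|mn] := ltnP n m.
  (* Here t is already in k, so the old family still spans. *)
  have Gt : G t.
    split; first by exists (a n) => //; apply: tower_union_gen.
    by rewrite /t -(subnKC nm) -frob_iter; apply: subfieldX.
  exists I, u; split=> // [i|_ [q Eq ->]];
    first exact: (simple_adjoin_sub _ hE).
  rewrite powE; apply: lspan_sum => // i; rewrite mulrC; apply: lspanZ => //.
    exact: subfieldX.
  exact: (spanu _ (Eq i)).
(* Here t has degree M over E: t^M is in k, while t^(M/p) = a_n^(p^n) is outside E. *)
set M := (p ^ (n - m).+1)%N.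
have tM : t ^+ M = a n ^+ (p ^ n.+1) by rewrite /t frob_iter addnS subnKC.
have GtM : G (t ^+ M).
  split; last by rewrite tM.
  exists (a n ^+ M); last by rewrite /t exprAC.
  by apply: subfieldX => //; apply: tower_union_gen.
have M0 : (0 < M)%N by apply: (expn_pchar_gt0 charp).
have iw : independent E (fun r : 'I_M => t ^+ r).
  apply: (insep_powers_independent charp hE); first exact: (kE _ GtM.2).
  by rewrite /t frob_iter subnKC //; apply: a_indep.
exists (I * 'I_M)%type, (fun ir : I * 'I_M => u ir.1 * t ^+ ir.2); split.
- exact: independent_tensor iw.
- have hE' : is_subfield (tower k a n.+1) by apply: tower_subfield.
  move=> ir; apply: (subfieldM hE'); first exact: (simple_adjoin_sub _ hE).
  by apply: (subfieldX hE'); apply: (subfieldX hE'); apply: tower_gen.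
- move=> _ [q Eq ->]; rewrite powE; apply: lspan_sum => // i.
  rewrite {2}(divn_eq i M) exprD mulnC exprM mulrA.
  apply: (@lspan_tensor _ G I 'I_M u (fun r =>
    t ^+ r) _ (Ordinal (ltn_pmod i M0))) => //.
  by rewrite mulrC; apply: lspanZ => //;
    [apply: subfieldX|exact: (spanu _ (Eq i))].
Qed.

(** Linear disjointness concerns finite families, and each of them comes from a finite stage of the
    tower. *)
Lemma tower_union_modular : modular p k L.
Proof.
move=> m; apply: lspan_lin_disjoint => //.
  by apply: subfieldI => //; apply: pow_img_subfield => //;
    apply: tower_union_subfield.
move=> l x /(_ _)/cid2-/all_sig2[y Ly yE].
have [n ny] := tower_union_fin Ly;
  have [I [u [iu _ spanu]]] := tower_pow_lspan m n.
by exists I, u; split=> // i; rewrite -yE; apply: spanu.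
Qed.

Lemma tower_union_unbounded : unbounded_exponent p k L.
Proof.
move=> [e Lk]; apply: (a_indep (n := e)); apply: tower_base => //.
by apply: Lk; exists (a e) => //; apply: tower_union_gen.
Qed.

End Modular.

(** Descend along the tower over k: at each stage a_n keeps its full degree over the larger tower
    over F, which contains z, so [simple_adjoin_descent] removes a_n. *)
Lemma tower_union_descent F z : is_subfield F -> k `<=` F -> F z ->
  (forall n, ~ tower F a n (a n ^+ (p ^ n))) -> L z -> k z.
Proof.
move=> hF kF Fz aF [n]; elim: n => //= n IHn az; apply: IHn.
apply: (simple_adjoin_descent (E := tower F a n) (e := n) charp _ _ _ _ _ _ az).
- exact: tower_subfield.
- exact: tower_subfield.
- exact: tower_subl.
- exact: tower_exp.
- exact: aF.
- exact: tower_base.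
Qed.

End Insep.

(** Dependent choice: the state is the current field with its index, and the choice function takes
    the dummy value 0 on fields violating [Inv], which are never reached. *)
Lemma tower_greedy F (Inv : set Omega -> Prop)
    (P : set Omega -> nat -> Omega -> Prop) :
  Inv F ->
  (forall E n, Inv E -> exists b, P E n b /\ Inv (simple_adjoin E b)) ->
  exists a, forall n, P (tower F a n) n (a n).
Proof.
move=> InvF next.
have /choice[f fP] (s : set Omega * nat) :
    exists b, Inv s.1 -> P s.1 s.2 b /\ Inv (simple_adjoin s.1 b).
  have [/(next _ s.2)[b Pb]|nI] := pselect (Inv s.1); first by exists b.
  by exists 0.
pose s n := iter n (fun s => (simple_adjoin s.1 (f s), s.2.+1)) (F, 0%N).
pose a n := f (s n).
have sE n : s n = (tower F a n, n).
  by elim: n => //= n IHn; rewrite /a IHn.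
have InvE n : Inv (tower F a n).
  elim: n => //= n IHn; have := fP (tower F a n, n) IHn.
  by rewrite /a sE => -[].
by exists a => n; have := fP (tower F a n, n) (InvE n); rewrite /a sE => -[].
Qed.

End Tower.

(** * Construction of L by a greedy choice over k(z) *)

Theorem mainTheorem2 (p : nat) (Omega : closedFieldType) (k K : set Omega)
    (T : Type) (C : set T)
    (charp : p \in [pchar Omega])
    (closure_k : is_algebraic_closure k)
    (extK : is_extension k K)
    (insepK : purely_insep p k K)
    (unbK : unbounded_exponent p k K)
    (diK : is_di p k K C)
    (infC : infinite_set C)
    (rperfK : relatively_perfect p k K)
    (modK : modular p k K) :
  exists L : set Omega,
    [/\ is_extension k L, L `<` K, unbounded_exponent p k L & modular p k L].
Proof.
have [hk hK kK] := extK.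
have dim_inf : ~ finite_dim k (K `&` pow_root p 1 k).
  exact: (infinite_di_root charp hk hK kK insepK rperfK modK diK infC).
have next E n : is_subfield E -> k `<=` E -> finite_dim k E ->
    exists b, [/\ K b, k (b ^+ (p ^ n.+1)) & ~ E (b ^+ (p ^ n))].
  move=> hE kE [I [u Eu]]; apply: contrapT => nex; apply: dim_inf.
  exists I, u; apply: subset_trans Eu.
  have rootA := pow_root_sub_adjoin charp hk hK kK insepK rperfK modK (j := 1)
    (n := n).
  apply: (subset_trans rootA); apply: adjoin_sub => // _ [[b Kb <-] kb].
  apply: contrapT => nEb; apply: nex; exists b; split=> //.
  by move: kb; rewrite /pow_root /= frob_iter addn1.
have fdk : finite_dim k k.
  exists unit, (fun=> 1) => x kx; exists (fun=> x) => //.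
  by rewrite (bigD1 tt) //= big1 ?addr0 ?mulr1 // => -[].
(* At n = 0 this yields z in K with z^p in k and z outside k. *)
have [z [Kz kz nkz]] := next k 0%N hk (@subset_refl _ k) fdk.
rewrite expr1 in nkz.
pose Inv E := [/\ is_subfield E, k `<=` E & finite_dim k E].
have InvA E n b : Inv E -> k (b ^+ (p ^ n)) -> Inv (simple_adjoin E b).
  move=> [hE kE fdE] kb; split.
  - by apply: (simple_adjoin_subfield charp hE (kE _ kb)).
  - by apply: (subset_trans kE); apply: simple_adjoin_sub.
  - exact: (simple_adjoin_finite_dim hk hE fdE (expn_pchar_gt0 charp n) (kE _
    kb)).
pose F := simple_adjoin k z.
have InvF : Inv F by apply: InvA kz; split.
have [a aP] := tower_greedy (P := fun E n b =>
    [/\ K b, k (b ^+ (p ^ n.+1)) & ~ E (b ^+ (p ^ n))]) InvF (fun E n InvE =>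
  let: And3 hE kE fdE := InvE in
  let: ex_intro b Pb := next E n hE kE fdE in
  ex_intro _ b (conj Pb (let: And3 _ kb _ := Pb in InvA _ _ _ InvE kb))).
have [hF kF _] := InvF.
have ka n : k (a n ^+ (p ^ n.+1)) by have [] := aP n.
have aF n : ~ tower F a n (a n ^+ (p ^ n)) by have [] := aP n.
(* Modularity and unboundedness use the condition over k; it follows from the one over F, which
   serves properness. *)
have ak n : ~ tower k a n (a n ^+ (p ^ n)).
  by move=> ?; apply: (aF n); apply: tower_subl kF _ _.
exists (tower_union k a); split.
- by split=> //;
  [apply: (tower_union_subfield charp hk ka)|apply: tower_union_base].
- split=> [x [n nx]|KL].
    by apply: (tower_min hK kK _ nx) => i; have [] := aP i.
  apply: nkz; apply: (tower_union_descent charp hk ka hF kF _ aF (KL _ Kz)).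
  exact: simple_adjoin_gen.
- exact: (tower_union_unbounded charp hk ka ak).
- exact: (tower_union_modular charp hk ka ak).
Qed.
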